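(* Let $n, d_{out}\ge 1$ be integers, let $\mathbf{s}\in\{-1,1\}^n$ be a vector in which both values $1$ and $-1$ occur, let $\Delta_{\mathbf{s}}\in\mathbb{R}^{1\times n}$ be the associated sensitive attribute incident vector, and let $\mathbf{u}\in\mathbb{R}^{1\times d_{out}}$ be fixed (independent of $\mathbf{F}$). For $\mathbf{F}\in\mathbb{R}^{n\times d_{out}}$ put $\mathbf{p}=\mathbf{p}(\mathbf{F})=\Delta_{\mathbf{s}}\, SF(\mathbf{F})\in\mathbb{R}^{1\times d_{out}}$, where $SF$ is the row-wise softmax. Then for every $\mathbf{F}\in\mathbb{R}^{n\times d_{out}}$ the gradient of the real-valued function $\mathbf{F}\mapsto\langle\mathbf{p}(\mathbf{F}),\mathbf{u}\rangle$ satisfies $$\frac{\partial\langle\mathbf{p},\mathbf{u}\rangle}{\partial\mathbf{F}}=\mathbf{U}_s\odot SF(\mathbf{F})-\mathrm{Sum}_1\big(\mathbf{U}_s\odot SF(\mathbf{F})\big)\odot SF(\mathbf{F}),$$ where $\mathbf{U}_s=\Delta_{\mathbf{s}}^{\top}\mathbf{u}\in\mathbb{R}^{n\times d_{out}}$.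
   Context: For $\mathbf{s}\in\{-1,1\}^n$, the sensitive attribute incident vector is $\Delta_{\mathbf{s}}=\frac{\mathbf{1}_{>0}(\mathbf{s})}{\|\mathbf{1}_{>0}(\mathbf{s})\|_1}-\frac{\mathbf{1}_{>0}(-\mathbf{s})}{\|\mathbf{1}_{>0}(-\mathbf{s})\|_1}$, regarded as a row vector in $\mathbb{R}^{1\times n}$, where $\mathbf{1}_{>0}(\cdot)$ is the element-wise indicator of being positive. Thus its $i$-th entry is $1/|\{k:\mathbf{s}_k=1\}|$ if $\mathbf{s}_i=1$ and $-1/|\{k:\mathbf{s}_k=-1\}|$ if $\mathbf{s}_i=-1$. The row-wise softmax $SF:\mathbb{R}^{n\times d_{out}}\to\mathbb{R}^{n\times d_{out}}$ is $SF(\mathbf{F})_{ij}=e^{\mathbf{F}_{ij}}/\sum_{k=1}^{d_{out}}e^{\mathbf{F}_{ik}}$. The inner product of matrices of equal size is $\langle\mathbf{X},\mathbf{Y}\rangle=\mathrm{tr}(\mathbf{X}^{\top}\mathbf{Y})$, so $\langle\mathbf{p},\mathbf{u}\rangle=\sum_{k=1}^{d_{out}}\mathbf{p}_k\mathbf{u}_k$. The gradient $\frac{\partial\langle\mathbf{p},\mathbf{u}\rangle}{\partial\mathbf{F}}$ is the $n\times d_{out}$ matrix whose $(i,j)$ entry is the partial derivative with respect to $\mathbf{F}_{ij}$. The symbol $\odot$ denotes the element-wise product. $\mathrm{Sum}_1(\mathbf{M})$ denotes summation over the column index with preserved matrix shape: for $\mathbf{M}\in\mathbb{R}^{n\times d_{out}}$,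 $\mathrm{Sum}_1(\mathbf{M})\in\mathbb{R}^{n\times d_{out}}$ has $(i,j)$ entry $\sum_{k=1}^{d_{out}}\mathbf{M}_{ik}$ for every $j$. *)

(* Defs.v *)
From mathcomp Require Import all_boot all_order all_algebra.
From mathcomp Require Import all_classical all_reals all_analysis.

Set Implicit Arguments.
Unset Strict Implicit.
Unset Printing Implicit Defensive.

Import Order.TTheory GRing.Theory Num.Theory.
Import numFieldNormedType.Exports.

Local Open Scope ring_scope.

Definition pos_indicator (R : realType) (n : nat) (v : 'rV[R]_n) : 'rV[R]_n :=
  map_mx (fun x : R => (0 < x)%R%:R) v.

(* The library norm on matrices is the sup norm, hence the explicit sum. *)
Definition norm1 (R : realType) (n : nat) (v : 'rV[R]_n) : R :=
  \sum_(i < n) `|v 0 i|.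

Definition incident_vector (R : realType) (n : nat) (s : 'rV[R]_n) : 'rV[R]_n :=
  (norm1 (pos_indicator s))^-1 *: pos_indicator s
  - (norm1 (pos_indicator (- s)))^-1 *: pos_indicator (- s).

Definition softmax (R : realType) (n d : nat) (F : 'M[R]_(n, d)) : 'M[R]_(n, d) :=
  \matrix_(i < n, j < d) (expR (F i j) / \sum_(k < d) expR (F i k)).

Definition mx_inner (R : realType) (m n : nat) (X Y : 'M[R]_(m, n)) : R :=
  \tr (X^T *m Y).

Definition hadamard (R : realType) (m n : nat) (X Y : 'M[R]_(m, n)) : 'M[R]_(m, n) :=
  map2_mx *%R X Y.

Definition sum1 (R : realType) (m n : nat) (M : 'M[R]_(m, n)) : 'M[R]_(m, n) :=
  \matrix_(i < m, j < n) \sum_(k < n) M i k.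

(* The partial derivative with respect to the (i, j) entry is the derivative
   along the elementary matrix [delta_mx i j]. Since ['D_v f a] is a total
   operator, existence of the partial derivatives is a separate predicate. *)
Definition has_partials (R : realType) (m n : nat)
    (f : 'M[R]_(m, n) -> R) (A : 'M[R]_(m, n)) : Prop :=
  forall (i : 'I_m) (j : 'I_n), derivable f A (delta_mx i j).

Definition gradient (R : realType) (m n : nat)
    (f : 'M[R]_(m, n) -> R) (A : 'M[R]_(m, n)) : 'M[R]_(m, n) :=
  \matrix_(i < m, j < n) 'D_(delta_mx i j) f A.

(* Main.v *)
(** Restricted to the line [h |-> h v + F], each softmax entry is a quotient
    of exponentials of affine functions, so with [S = softmax F] its derivative
    at [h = 0] is [S_ik (v_ik - \sum_l S_il v_il)].  The functional is a fixed
    linear form in these entries, and taking [v] elementary leaves only the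
    contributions of row [i]. *)

Require Import Defs.
From mathcomp Require Import all_boot all_order all_algebra.
From mathcomp Require Import all_classical all_reals all_analysis.
From mathcomp Require Import ring.

Import Order.TTheory GRing.Theory Num.Theory.
Import numFieldNormedType.Exports.

Local Open Scope ring_scope.

(** The difference quotient of [f] at [a] along [v] is, for each [h], exactly that of the
    restriction to the line at [0] along [1]. One-variable rules thus yield directional derivatives
    on matrices. *)
Lemma is_derive_line (R : realType) (V W : normedModType R) (f : V -> W)
    (a v : V) (df : W) :
  is_derive (0 : R) 1 (fun h : R => f (h *: v + a)) df -> is_derive a v f df.
Proof.
have E : (fun h : R => h^-1 *: (((fun t : R => f (t *: v + a)) \o shift 0) (h *: 1)
    - f (0 *: v + a))) = (fun h : R => h^-1 *: ((f \o shift a) (h *: v) - f a)).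
  apply/funext => h /=.
  by rewrite addr0 scale0r add0r [h *: 1]mulr1.
case=> dg eg; apply: DeriveDef; first by move: dg; rewrite /derivable E.
by move: eg; rewrite /derive E.
Qed.

Lemma is_derive_pointwise_sum (R : realType) (d : nat) (g : 'I_d -> R -> R)
    (dg : 'I_d -> R) (x v : R) :
  (forall i, is_derive x v (g i) (dg i)) ->
  is_derive x v (fun h => \sum_i g i h) (\sum_i dg i).
Proof. by move=> H; rewrite -fct_sumE; exact: is_derive_sum. Qed.

Lemma is_derive_mulr (R : realType) (f : R -> R) (c x v df : R) :
  is_derive x v f df -> is_derive x v (fun h => f h * c) (df * c).
Proof.
move=> H; rewrite mulrC.
have -> : (fun h => f h * c) = c \*: f by apply/funext => h; rewrite /= mulrC.
exact: is_deriveZ.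
Qed.

(** The index [k] witnesses [d > 0]; an empty sum would be [0]. *)
Lemma sum_expR_gt0 (R : realType) (d : nat) (k : 'I_d) (a : 'I_d -> R) :
  0 < \sum_l expR (a l).
Proof.
rewrite (bigD1 k) //= ltr_pwDl ?expR_gt0 //.
by apply: sumr_ge0 => l _; exact: expR_ge0.
Qed.

Lemma is_derive_softmax_line (R : realType) (n d : nat) (F v : 'M[R]_(n, d))
    (i : 'I_n) (k : 'I_d) :
  is_derive (0 : R) 1 (fun h : R => softmax (h *: v + F) i k)
    (softmax F i k * (v i k - \sum_l softmax F i l * v i l)).
Proof.
have dE l : is_derive (0 : R) 1 (fun h : R => expR (h * v i l + F i l))
    (expR (F i l) * v i l).
  apply: is_derive1_comp; first by rewrite mul0r add0r; exact: is_derive_expR.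
  (* The slope is put in the form [1 * v i l + 0] that the rules give for identity times constant,
     plus constant. *)
  rewrite -[X in is_derive _ _ _ X]mul1r -[X in is_derive _ _ _ X]addr0.
  exact: is_deriveD (is_derive_mulr _ _ _ _ _ _ _) _.
have dS := is_derive_pointwise_sum _ _ _ _ _ _ dE.
have eS : \sum_l expR (0 * v i l + F i l) = \sum_l expR (F i l).
  by apply: eq_bigr => l _; rewrite mul0r add0r.
have S_neq0 : \sum_l expR (F i l) != 0 by rewrite gt_eqF ?(sum_expR_gt0 _ _ k).
have -> : (fun h : R => softmax (h *: v + F) i k) =
    (fun h => expR (h * v i k + F i k)) *
    (fun h => (\sum_l expR (h * v i l + F i l))^-1).
  apply/funext => h /=; rewrite mxE !mxE; congr (_ / _).
  by apply: eq_bigr => l _; rewrite !mxE.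
apply: is_derive_eq.
  by apply: is_deriveM (dE k) (is_deriveV _ dS); rewrite eS.
rewrite /= eS mul0r add0r.
(* Pulling out the common denominator leaves a rational identity in [S], [T] and entries of row [i],
   within reach of [field]. *)
have -> : \sum_l softmax F i l * v i l =
    (\sum_l expR (F i l) * v i l) / \sum_l expR (F i l).
  by rewrite mulr_suml; apply: eq_bigr => l _; rewrite mxE mulrAC.
rewrite mxE; move: S_neq0.
set S := \sum_l expR (F i l); set T := \sum_l _ => S_neq0.
rewrite /GRing.scale /=; field.
exact: S_neq0.
Qed.

Lemma mx_innerE (R : realType) (d : nat) (x y : 'rV[R]_d) :
  mx_inner x y = \sum_k x 0 k * y 0 k.
Proof.
by rewrite /mx_inner /mxtrace; apply: eq_bigr => k _; rewrite mxE big_ord1 mxE.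
Qed.

(** With the direction [v] left general, this one formula gives both the existence of all partials
    and every gradient entry; [w] will be the incident vector. *)
Lemma is_derive_softmax_form (R : realType) (n d : nat) (w : 'rV[R]_n)
    (u : 'rV[R]_d) (F v : 'M[R]_(n, d)) :
  is_derive F v (fun X : 'M[R]_(n, d) => mx_inner (w *m softmax X) u)
    (\sum_k (\sum_a
       softmax F a k * (v a k - \sum_l softmax F a l * v a l) * w 0 a) * u 0 k).
Proof.
apply: is_derive_line.
have -> : (fun h : R => mx_inner (w *m softmax (h *: v + F)) u) =
    fun h => \sum_k (\sum_a softmax (h *: v + F) a k * w 0 a) * u 0 k.
  apply/funext => h; rewrite mx_innerE; apply: eq_bigr => k _.
  by rewrite mxE; congr (_ * _); apply: eq_bigr => a _; rewrite mulrC.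
apply: is_derive_pointwise_sum => k; apply: is_derive_mulr.
apply: is_derive_pointwise_sum => a; apply: is_derive_mulr.
exact: is_derive_softmax_line.
Qed.

Theorem theorem3p2 (R : realType) (n d_out : nat)
    (n_ge1 : (1 <= n)%N) (d_out_ge1 : (1 <= d_out)%N)
    (s : 'rV[R]_n)
    (s_pm1 : forall i : 'I_n, s 0 i = 1 \/ s 0 i = -1)
    (s_pos : exists i : 'I_n, s 0 i = 1)
    (s_neg : exists i : 'I_n, s 0 i = -1)
    (u : 'rV[R]_d_out) (F : 'M[R]_(n, d_out)) :
  let p (X : 'M[R]_(n, d_out)) : 'rV[R]_d_out :=
    incident_vector s *m softmax X in
  let f (X : 'M[R]_(n, d_out)) : R := mx_inner (p X) u in
  let U_s : 'M[R]_(n, d_out) := (incident_vector s)^T *m u in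
  has_partials f F /\
  gradient f F =
    hadamard U_s (softmax F)
    - hadamard (sum1 (hadamard U_s (softmax F))) (softmax F).
Proof.
move=> p f U_s; rewrite /f /p.
have D v := is_derive_softmax_form _ _ _ (incident_vector s) u F v.
split; first by move=> i j; have [] := D (delta_mx i j).
apply/matrixP => i j; rewrite mxE; have [_ ->] := D (delta_mx i j).
set w := incident_vector s.
have dot a : \sum_l softmax F a l * delta_mx i j a l = softmax F a j * (a == i)%:R.
  rewrite (bigD1 j) //= big1 ?addr0; first by rewrite [delta_mx _ _ _ _]mxE eqxx andbT.
  by move=> l /negbTE lj; rewrite [delta_mx _ _ _ _]mxE lj andbF mulr0.
(* In a row [a != i] the direction vanishes, and by [dot] so does its softmax-weighted mean; only
   row [i] survives. *)
have inner k : \sum_a softmax F a k *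
      (delta_mx i j a k - \sum_l softmax F a l * delta_mx i j a l) * w 0 a =
    softmax F i k * ((k == j)%:R - softmax F i j) * w 0 i.
  rewrite (bigD1 i) //= [X in _ + X]big1 ?addr0.
    by rewrite dot [delta_mx _ _ _ _]mxE eqxx mulr1 andTb.
  by move=> a /negbTE ai; rewrite dot [delta_mx _ _ _ _]mxE ai /= mulr0 subr0 mulr0 mul0r.
under eq_bigr do rewrite inner.
have U_sE k : U_s i k = w 0 i * u 0 k by rewrite mxE big_ord1 mxE.
have hadE k : hadamard U_s (softmax F) i k = w 0 i * u 0 k * softmax F i k.
  by rewrite [LHS]mxE U_sE.
rewrite [RHS]mxE hadE [X in _ = _ + X]mxE [hadamard (sum1 _) _ i j]mxE [sum1 _ i j]mxE.
rewrite mulr_suml -sumrN.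
(* The term outside [sum1] becomes a sum against a Kronecker delta, so that both sides can be
   compared summand by summand. *)
have -> : w 0 i * u 0 j * softmax F i j =
    \sum_k w 0 i * u 0 k * softmax F i k * (k == j)%:R.
  rewrite (bigD1 j) //= big1 ?addr0; first by rewrite eqxx mulr1.
  by move=> k /negbTE ->; rewrite mulr0.
rewrite -big_split; apply: eq_bigr => k _ /=; rewrite hadE; ring.
Qed.
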